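(* Assume that a compact metric group $G$ acts continuously on a metric graph $\Gamma$. Assume also that positive numbers $a,\kappa,\kappa'$ and a point $x\in\Gamma$ satisfy $\kappa'<\kappa$, $a<a_\Gamma$, and $$\max\Big\{2\omega_x\Big(+\operatorname{Sep}\Big(G;\frac{\kappa}{3},\frac{\kappa}{3}\Big)\Big),\ 4\omega_x\Big(+\operatorname{Sep}\Big(G;\frac{1-\kappa}{3},\kappa'\Big)\Big)\Big\}<a.$$ Put $$s_{x,\kappa,\kappa'}:=\max\Big\{\frac a2+2\omega_x\Big(+\operatorname{Sep}\Big(G;\frac{\kappa}{3},\kappa\Big)\Big),\ \frac{\pi}{\sqrt2}\,\omega_x\Big(+\operatorname{Sep}\Big(G;\frac{\kappa-\kappa'}{4},\frac{\kappa-\kappa'}{4}\Big)\Big)\Big\}.$$ Then there exists a point $z_{x,\kappa,\kappa'}\in Gx$ such that $$d_\Gamma(z_{x,\kappa,\kappa'},gz_{x,\kappa,\kappa'})\leq s_{x,\kappa,\kappa'}+\rho(s_{x,\kappa,\kappa'})$$ for any $g\in G$.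
   Context: Metric graph: let $\Gamma=(V,E)$ be a (possibly infinite) undirected connected combinatorial graph, i.e. a 1-dimensional cell complex with vertex set $V$ and edge set $E$; multiple edges and loops are allowed. To vertices $v,w\in V$ which are endpoints of an edge a positive number $a_{v,w}$ is assigned, such that $a_\Gamma:=\inf_{v'\neq w'}a_{v'w'}>0$ (infimum over pairs of distinct endpoints of edges). Every edge with endpoints $v,w$ is identified with a bounded closed interval, or a circle in $\mathbb{R}^2$ if it is a loop, of length $a_{vw}$. The distance $d_\Gamma$ between two points of $\Gamma$ is the infimum of the lengths of paths joining them. A compact metric group $G$ carries a metric $d_G$ and the Haar measure $\mu_G$ normalized by $\mu_G(G)=1$. For $\kappa_1,\kappa_2\geq0$, $\operatorname{Sep}(G;\kappa_1,\kappa_2)$ is the supremum of $d_G(A,B)=\inf_{a\in A,b\in B}d_G(a,b)$ over Borel subsets $A,B\subseteq G$ with $\mu_G(A)\geq\kappa_1$, $\mu_G(B)\geq\kappa_2$. For the action of $G$ on $\Gamma$, $\rho(\eta)\in[0,\infty]$ is the supremum of $d_\Gamma(gy,gz)$ over all $g\in G$ and $y,z\in\Gamma$ with $d_\Gamma(y,z)\leq\eta$; $\omega_x(\eta)\in[0,\infty]$ is the supremum of $d_\Gamma(gx,g'x)$ over all $g,g'\in G$ with $d_G(g,g')\leq\eta$; $\omega_x(+\eta):=\lim_{\eta'\downarrow\eta}\omega_x(\eta')$ for $\eta\geq 0$. $Gx$ is the orbit of $x$. *)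

(* Defs.v *)
From HB Require Import structures.
From mathcomp Require Import all_boot all_order all_algebra.
From mathcomp Require Import all_classical all_reals all_analysis.
From mathcomp Require Import lra.
From Stdlib Require Import Relation_Operators.
Set Implicit Arguments.
Unset Strict Implicit.
Unset Printing Implicit Defensive.
Import Order.TTheory GRing.Theory Num.Theory.
Import numFieldNormedType.Exports.
Local Open Scope classical_set_scope.
Local Open Scope ring_scope.

HB.mixin Record isTopologicalGroup G & Topological G & Group G := {
  mulg_continuous : continuous (fun gh : G * G => (gh.1 * gh.2)%g) ;
  invg_continuous : continuous (fun g : G => (g^-1)%g) }.

(* The base point carried by [Pointed] is unrelated to the group structure; the
   library requires one on every measurable type. *)
#[short(type="metricGroupType")]
HB.structure Definition MetricGroup (R : realType) :=
  { G of Pointed G & Metric R G & Group G & isTopologicalGroup G }.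

Definition borel (R : realType) (G : metricGroupType R) :=
  g_sigma_algebraType (@open G).

(* A left-invariant Borel probability measure on a compact metric group is its
   normalized Haar measure. *)
Definition is_haar (R : realType) (G : metricGroupType R)
    (mu : probability (borel G) R) : Prop :=
  forall (g : G) (A : set (borel G)), measurable A ->
    mu [set (g * h)%g | h in (A : set G)] = mu A.

Section Separation.
Context {R : realType} {G : metricGroupType R}.

Definition set_dist (A B : set G) : R := inf [set mdist a b | a in A & b in B].

(* For [k1, k2 <= 1] and [G] compact, the set of values is nonempty (it contains
   [set_dist setT setT]) and bounded by the diameter, so [sup] is the true
   supremum. Nonemptiness of [A] and [B] only matters when [k1] or [k2] is [0]. *)
Definition Sep (mu : probability (borel G) R) (k1 k2 : R) : R :=
  sup [set r | exists A B : set (borel G),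
    [/\ measurable A /\ measurable B,
        (k1%:E <= mu A)%E /\ (k2%:E <= mu B)%E,
        A !=set0 /\ B !=set0
      & r = set_dist A B]].

End Separation.

(* The infimum over the empty family (all edges are loops) is [+oo]. *)
Definition min_length (R : realType) (V E : Type) (src tgt : E -> V)
    (len : V -> V -> R) : \bar R :=
  ereal_inf [set (len (src e) (tgt e))%:E | e in [set e | src e <> tgt e]].

(* Edges form a type of their own, so multiple edges and loops are allowed.
   [src] and [tgt] only choose a direction in which to parametrize an edge, and
   [len v w] is only meaningful when [v] and [w] are the endpoints of an edge. *)
Record metric_graph (R : realType) := MetricGraph {
  vertex : Type ;
  edge : Type ;
  src : edge -> vertex ;
  tgt : edge -> vertex ;
  len : vertex -> vertex -> R ;
  len_sym : forall v w, len v w = len w v ;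
  len_gt0 : forall e, 0 < len (src e) (tgt e) ;
  min_length_gt0 : (0 < min_length src tgt len)%E ;
  graph_connected : forall v w,
    clos_refl_sym_trans vertex (fun v' w' => exists e, src e = v' /\ tgt e = w')
      v w }.

Definition a_graph (R : realType) (X : metric_graph R) : \bar R :=
  min_length (@src _ X) (@tgt _ X) (@len _ X).

Definition edge_len (R : realType) (X : metric_graph R) (e : edge X) : R :=
  len (src e) (tgt e).

Inductive gpoint (R : realType) (X : metric_graph R) : Type :=
| Vertex of vertex X
| Inner (e : edge X) (t : R) of 0 < t < edge_len e.

Local Ltac case_minmax :=
  repeat match goal with
  | |- context [Order.min ?a ?b] =>
      lazymatch b with context [Order.min _ _] => fail | _ => case: (lerP a b) => ? end
  | |- context [Order.max ?a ?b] =>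
      lazymatch b with context [Order.max _ _] => fail | _ => case: (lerP a b) => ? end
  end.

Section GraphDistance.
Context {R : realType} {X : metric_graph R}.
Implicit Types (p q : gpoint X) (e : edge X).

(* [on_edge e t p]: [p] is the point with parameter [t] on the closed edge [e],
   parametrized by arc length on [[0, edge_len e]]. When [e] is a loop, [0] and
   [edge_len e] are parameters of the same point. *)
Definition on_edge e (t : R) p : Prop :=
  match p with
  | Vertex v => (t = 0 /\ v = src e) \/ (t = edge_len e /\ v = tgt e)
  | Inner e' t' _ => e = e' /\ t = t'
  end.

(* [gpath p q r]: some finite concatenation of segments of closed edges goes from
   [p] to [q] and has total length [r]. *)
Inductive gpath : gpoint X -> gpoint X -> R -> Prop :=
| path_nil p : gpath p p 0
| path_cons e s t p p' q r :
    on_edge e s p -> on_edge e t p' -> gpath p' q r ->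
    gpath p q (`|s - t| + r).

Definition gdist p q : R := inf [set r | gpath p q r].

Lemma path_seg e s t p q : on_edge e s p -> on_edge e t q -> gpath p q `|s - t|.
Proof.
move=> ep eq; rewrite -[`|_|]addr0.
by apply: (path_cons ep eq); exact: path_nil.
Qed.

Lemma path_cat p q o r r' : gpath p q r -> gpath q o r' -> gpath p o (r + r').
Proof.
move=> pq qo; elim: pq r' qo => {p q r} [p r' qo|e s t p p' q r ep ep' _ IH r' qo].
  by rewrite add0r.
by rewrite -addrA; apply: path_cons ep ep' (IH _ qo).
Qed.

Lemma path_rev p q r : gpath p q r -> gpath q p r.
Proof.
elim=> {p q r} [p|e s t p p' q r ep ep' _ IH]; first exact: path_nil.
by rewrite addrC distrC; apply: path_cat IH _; apply: path_seg ep' ep.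
Qed.

Lemma path_ge0 p q r : gpath p q r -> 0 <= r.
Proof. by elim=> // *; rewrite addr_ge0. Qed.

Lemma path_vertex (v w : vertex X) : exists r, gpath (Vertex v) (Vertex w) r.
Proof.
elim: (graph_connected v w) => {v w} [_ _ [e [<- <-]]|v|v w _ [r vw]|v w u _ [r vw] _ [r' wu]].
- by eexists; apply: (@path_seg e 0 (edge_len e)); [left|right].
- by exists 0; exact: path_nil.
- by exists r; exact: path_rev.
- by exists (r + r'); exact: path_cat vw wu.
Qed.

Lemma path_to_vertex p : exists v r, gpath p (Vertex v) r.
Proof.
case: p => [v|e t te]; first by exists v, 0; exact: path_nil.
by exists (src e); eexists; apply: (@path_seg e t 0); [split|left].
Qed.

Lemma path_nonempty p q : [set r | gpath p q r] !=set0.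
Proof.
have [v [r pv]] := path_to_vertex p; have [w [r' qw]] := path_to_vertex q.
have [r'' vw] := path_vertex v w.
by eexists; apply: path_cat pv (path_cat vw (path_rev qw)).
Qed.

Lemma path_lbound p q : has_lbound [set r | gpath p q r].
Proof. by exists 0 => r; exact: path_ge0. Qed.

Lemma gdist_ge0 p q : 0 <= gdist p q.
Proof. by apply: (lb_le_inf (path_nonempty p q)) => r; exact: path_ge0. Qed.

Lemma gdistxx p : gdist p p = 0.
Proof.
apply/eqP; rewrite eq_le gdist_ge0 andbT.
by apply: (ge_inf (path_lbound p p)); exact: path_nil.
Qed.

Lemma gdist_sym p q : gdist p q = gdist q p.
Proof.
by congr inf; apply/seteqP; split=> r; exact: path_rev.
Qed.

Lemma gdist_triangle q p o : gdist p o <= gdist p q + gdist q o.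
Proof.
rewrite -lerBlDr; apply: (lb_le_inf (path_nonempty p q)) => r pq.
rewrite lerBlDr -lerBlDl; apply: (lb_le_inf (path_nonempty q o)) => r' qo.
by rewrite lerBlDl; apply: (ge_inf (path_lbound p o)); exact: path_cat pq qo.
Qed.

Lemma gdist_lipschitz (f : gpoint X -> R) :
    (forall e s t p q, on_edge e s p -> on_edge e t q -> f p - f q <= `|s - t|) ->
  forall p q, f p - f q <= gdist p q.
Proof.
move=> lf p q; apply: (lb_le_inf (path_nonempty p q)) => r.
elim=> {p q r} [p|e s t p p' q r ep ep' _ IH]; first by rewrite subrr.
by have := lf _ _ _ _ _ ep ep'; lra.
Qed.

Let vbump (v : vertex X) (c : R) (w : vertex X) : R := if pselect (w = v) then c else 0.

Let bumpv v c p : R :=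
  match p with
  | Vertex w => vbump v c w
  | Inner e t _ => Num.max (vbump v c (src e) - t)
                     (Num.max (vbump v c (tgt e) - (edge_len e - t)) 0)
  end.

Let bumpe e (t c : R) p : R :=
  match p with
  | Inner e' t' _ => if pselect (e' = e) then Num.max (c - `|t - t'|) 0 else 0
  | Vertex _ => 0
  end.

Lemma gdist_positivity p q : gdist p q = 0 -> p = q.
Proof.
have vertexE v w : gdist (Vertex v) (Vertex w) = 0 -> v = w :> vertex X.
  move=> d0; apply: contrapT => vw.
  have [c [c0 cE]] : exists c : R, 0 < c /\
      forall e, src e <> tgt e -> c <= edge_len e.
    have a0 : (0 < a_graph X)%E := min_length_gt0 X.
    case a: (a_graph X) a0 => [c| |] // a0.
    - exists c; split=> // e ne; rewrite -lee_fin -a.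
      by apply: ereal_inf_lbound; exists e.
    - exists 1; split=> // e ne.
      suff : (+oo <= (edge_len e)%:E)%E by [].
      by rewrite -a; apply: ereal_inf_lbound; exists e.
  have bE e t o : on_edge e t o ->
      0 <= t <= edge_len e /\
      bumpv v c o = Num.max (vbump v c (src e) - t)
                     (Num.max (vbump v c (tgt e) - (edge_len e - t)) 0).
    have := len_gt0 e; rewrite -/(edge_len e) => l0.
    case: o => [u|e' t' te'] /=; last first.
      by move=> [-> ->]; split=> //; move: te' => /andP[]; lra.
    have := cE e; rewrite /vbump => ce.
    case=> [[-> ->]|[-> ->]]; (split; first lra);
      case: pselect => sv; case: pselect => tv /=; case_minmax; try lra;
      by (have /ce ? : src e <> tgt e by congruence); lra.
  have lip e s t p' q' : on_edge e s p' -> on_edge e t q' ->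
      bumpv v c p' - bumpv v c q' <= `|s - t|.
    move=> /bE[s0 ->] /bE[t0 ->].
    have h1 : s - t <= `|s - t| := ler_norm _.
    have h2 : t - s <= `|s - t| by rewrite distrC ler_norm.
    by case_minmax; lra.
  have := gdist_lipschitz lip (Vertex v) (Vertex w); rewrite d0 /= /vbump.
  case: pselect => //= _; case: pselect => [wv|_] /=; first by case: vw.
  by lra.
have innerE e t (te : 0 < t < edge_len e) o : gdist (Inner te) o = 0 -> Inner te = o.
  move=> d0; apply: contrapT => no; have [t0 tl] := andP te.
  have [c [c0 [ct cl]] co] : exists2 c : R, 0 < c /\ c <= t /\ c <= edge_len e - t &
      bumpe e t c o = 0.
    case: o no {d0} => [v|e' t' te'] no /=.
      by exists (Num.min t (edge_len e - t)) => //; case_minmax; repeat split; lra.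
    case: pselect => ee /=; last first.
      by exists (Num.min t (edge_len e - t)) => //; case_minmax; repeat split; lra.
    subst e'; have tt : t != t'.
      apply/eqP => tt; subst t'; apply: no; congr Inner; exact: bool_irrelevance.
    have tt0 : 0 < `|t - t'| by rewrite normr_gt0 subr_eq0.
    exists (Num.min `|t - t'| (Num.min t (edge_len e - t))).
      by case_minmax; repeat split; lra.
    by case_minmax; lra.
  have bE u p' : on_edge e u p' -> bumpe e t c p' = Num.max (c - `|t - u|) 0.
    case: p' => [v|e' t' te'] /=; last by move=> [<- <-]; case: pselect.
    case=> [[-> _]|[-> _]]; [rewrite ger0_norm|rewrite ler0_norm]; case_minmax; lra.
  have bN e' u p' : e' <> e -> on_edge e' u p' -> bumpe e t c p' = 0.
    by move=> ne; case: p' => [v|e'' t' te'] //= [<- _]; case: pselect.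
  have lip e' s u p' q' : on_edge e' s p' -> on_edge e' u q' ->
      bumpe e t c p' - bumpe e t c q' <= `|s - u|.
    move=> ep eq; case: (pselect (e' = e)) => [ee|ne]; last first.
      by rewrite (bN _ _ _ ne ep) (bN _ _ _ ne eq) subrr.
    subst e'; rewrite (bE _ _ ep) (bE _ _ eq).
    have h := ler_distD s t u.
    have n0 : 0 <= `|s - u| by [].
    by case_minmax; lra.
  have := gdist_lipschitz lip (Inner te) o; rewrite d0 co /=.
  case: pselect => //= _; rewrite subrr normr0 subr0.
  by case_minmax; lra.
case: p => [v|e t te]; last exact: innerE.
case: q => [w|e t te]; first by move=> /vertexE ->.
by rewrite gdist_sym => /innerE.
Qed.

End GraphDistance.

HB.instance Definition _ (R : realType) (X : metric_graph R) :=
  gen_eqMixin (gpoint X).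
HB.instance Definition _ (R : realType) (X : metric_graph R) :=
  gen_choiceMixin (gpoint X).
HB.instance Definition _ (R : realType) (X : metric_graph R) :=
  isMetric.Build R (gpoint X) (@gdistxx R X) (@gdist_positivity R X)
    (@gdist_sym R X) (@gdist_triangle R X).

Section Action.
Context {R : realType} {G : metricGroupType R} {X : metricType R}.
Context (act : G -> X -> X).

Definition continuous_action : Prop :=
  [/\ forall x, act 1%g x = x,
      forall g h x, act (g * h)%g x = act g (act h x)
    & continuous (fun gx : G * X => act gx.1 gx.2)].

Definition act_orbit (x : X) : set X := range (act^~ x).

Definition rho (eta : \bar R) : \bar R :=
  ereal_sup [set r | exists g y z,
    ((mdist y z)%:E <= eta)%E /\ r = (mdist (act g y) (act g z))%:E].

Definition omega (x : X) (eta : R) : \bar R :=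
  ereal_sup [set r | exists g g',
    mdist g g' <= eta /\ r = (mdist (act g x) (act g' x))%:E].

Definition omega_plus (x : X) (eta : R) : \bar R :=
  lim (omega x eta' @[eta' --> eta^'+]).

End Action.

(* Main.v *)
Require Import Defs.
From mathcomp Require Import all_boot all_order all_algebra finmap.
From mathcomp Require Import all_classical all_reals all_analysis.
From mathcomp Require Import lra.
Import Order.TTheory GRing.Theory Num.Theory.
Import numFieldNormedType.Exports.
Local Open Scope classical_set_scope.
Local Open Scope ring_scope.

(** Write [nu] for the image of the Haar measure on the orbit, [c] for
    [(kappa - kappa') / 4] and [W] for [omega_x (+Sep (c, c))]. A set of mass at
    least [c] and any of its translates are within [W] of each other. Hence, as
    soon as some set of diameter at most [D] has mass at least [c], where
    [D + W <= s], any point [z] of the orbit in that set satisfies the conclusion.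
    Suppose there is no such set; as [s >= a / 2] and [s >= 2.12 W], this applies
    to [D = a / 2 - W] and to [D = 1.12 W].

    An open edge then has mass less than [3 c]: otherwise, cut the circle formed
    by the edge and the rest of the graph into four consecutive arcs of mass at
    least [c]; the first and the third are within [W] of each other, so the second
    or the fourth is a short segment. By the condition on
    [Sep ((1 - kappa) / 3, kappa')], the part of an edge at depth at least [a / 4]
    has mass less than [(1 - kappa) / 3], and by the condition on
    [Sep (kappa / 3, kappa / 3)] the union of these parts has mass less than
    [(1 + kappa) / 3]. So the balls of radius [a / 4] around the vertices have
    total mass more than [(2 - kappa) / 3]. If each had mass less than [c], they
    could be grouped into families of mass between [(1 - kappa) / 3] and
    [(1 - kappa) / 3 + c], and each family would have mass at least [1 - kappa']
    after doubling the radii, which is too much.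

    Hence some ball [B (v, a / 4)] has mass at least [c], so that [1.12 W < a / 2],
    and there is a radius [r] between [a / 8] and [a / 4] with [W < 2 r] for which
    all balls [B (w, r)] have mass less than [c]. An enlargement of [B (v, a / 4)]
    has mass at least [4 c], of which at least [3 c] lies at depth at least [r] in
    the edges; since [W < 2 r], a single edge contains mass [c] there, and
    enlarging this part shows that the edge has mass at least [3 c], a
    contradiction. *)

Ltac minmax := repeat
  match goal with
  | |- context [Order.min ?a ?b] => case: (lerP a b) => ?
  | |- context [Order.max ?a ?b] =>
      lazymatch b with context [Order.min _ _] => fail | _ => case: (lerP a b) => ? end
  end; lra.

(** * Distances in a metric graph *)

Section Graph.
Context {R : realType} {X : metric_graph R}.
Implicit Types (p q : gpoint X) (e : edge X) (v : vertex X) (r s t : R).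

(** For [0 <= lo] and [hi <= edge_len e] this is 1-Lipschitz on the whole graph, so it both makes
    segments measurable and bounds distances from below. *)
Definition tent e lo hi p : R :=
  match p with
  | Vertex _ => 0
  | Inner e' t _ => if pselect (e' = e) then Num.max 0 (Num.min (t - lo) (hi - t)) else 0
  end.

Definition depth e := tent e 0 (edge_len e).

Lemma tent_ge0 e lo hi p : 0 <= tent e lo hi p.
Proof. by case: p => [v|e' t te] //=; case: pselect => //= _; rewrite le_max lexx. Qed.

Lemma edge_len_gt0 e : 0 < edge_len e.
Proof. exact: len_gt0. Qed.

Lemma tent_on_edge e lo hi t p : 0 <= lo -> hi <= edge_len e ->
  on_edge e t p -> tent e lo hi p = Num.max 0 (Num.min (t - lo) (hi - t)).
Proof.
move=> lo0 hil.
case: p => [v|e' t' te] /=; last by move=> [<- <-]; case: pselect.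
by case=> -[-> _]; minmax.
Qed.

Lemma tent_off_edge e e' lo hi t p : e' <> e -> on_edge e' t p -> tent e lo hi p = 0.
Proof.
by move=> ne; case: p => [v|e'' t' te] //= [<- _]; case: pselect.
Qed.

Lemma tent_lip e lo hi p q : 0 <= lo -> hi <= edge_len e ->
  tent e lo hi p - tent e lo hi q <= gdist p q.
Proof.
move=> lo0 hil; apply: gdist_lipschitz => e' s t p' q' ep eq.
have [ee|ne] := pselect (e' = e); last first.
  by rewrite (tent_off_edge _ _ _ _ _ _ ne ep) (tent_off_edge _ _ _ _ _ _ ne eq) subrr.
subst e'; rewrite (tent_on_edge _ _ _ _ _ lo0 hil ep) (tent_on_edge _ _ _ _ _ lo0 hil eq).
have h1 : s - t <= `|s - t| := ler_norm _.
have h2 : t - s <= `|s - t| by rewrite distrC ler_norm.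
by minmax.
Qed.

Lemma gdist_on_edge e s t p q : on_edge e s p -> on_edge e t q -> gdist p q <= `|s - t|.
Proof. by move=> ep eq; apply: ge_inf; [exact: path_lbound|exact: path_seg ep eq]. Qed.

Lemma tent_gt0 e lo hi p : 0 < tent e lo hi p -> exists t, on_edge e t p /\ lo < t < hi.
Proof.
case: p => [v|e' t te] /=; first by rewrite ltxx.
case: pselect => [ee|_] /=; last by rewrite ltxx.
subst e'; rewrite lt_max ltxx /= lt_min !subr_gt0 => h; by exists t.
Qed.

Lemma depth_gtP r p : 0 <= r -> (forall v, r < gdist p (Vertex v)) ->
  exists e, r < depth e p.
Proof.
move=> r0; case: p => [v /(_ v)|e t te h].
  by rewrite gdistxx ltNge r0.
exists e; rewrite /depth /=; case: pselect => // _ /=.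
have hs := h (src e); have ht := h (tgt e).
have e1 : on_edge e 0 (Vertex (src e)) by left.
have e2 : on_edge e (edge_len e) (Vertex (tgt e)) by right.
have e3 : on_edge e t (Inner te) by [].
have := gdist_on_edge _ _ _ _ _ e3 e1; have := gdist_on_edge _ _ _ _ _ e3 e2.
have /andP[t0 tl] := te.
rewrite subr0 (gtr0_norm t0) distrC (@gtr0_norm _ (_ - t)) ?subr_gt0 //.
by minmax.
Qed.

(** [depth e - depth e'] is 1-Lipschitz, since along any edge at most one of the two terms is
    nonzero; it drops by at least [2 * r] from [p] to [q]. *)
Lemma depth_sep e e' r p q : e <> e' -> r <= depth e p -> r <= depth e' q -> 0 < r ->
  2 * r <= gdist p q.
Proof.
move=> ee' hp hq r0.
have lip : depth e p - depth e' p - (depth e q - depth e' q) <= gdist p q.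
  apply: (@gdist_lipschitz _ _ (fun p => depth e p - depth e' p)) => f s t p' q' fp fq.
  have [fe|fe] := pselect (f = e).
    subst f; rewrite /depth !(tent_off_edge _ _ _ _ _ _ ee' fp) !(tent_off_edge _ _ _ _ _ _ ee' fq).
    rewrite !subr0.
    apply: le_trans (tent_lip _ _ _ _ _ _ _) (gdist_on_edge _ _ _ _ _ fp fq) => //.
  rewrite /depth !(tent_off_edge _ _ _ _ _ _ fe fp) !(tent_off_edge _ _ _ _ _ _ fe fq).
  rewrite !sub0r opprK addrC (le_trans (tent_lip _ _ _ _ _ _ _)) //.
  by rewrite distrC; exact: gdist_on_edge fq fp.
have z (g : edge X) o : 0 < depth e o -> g <> e -> depth g o = 0.
  move=> /tent_gt0[t [oe _]] ge; apply: tent_off_edge oe; exact/nesym.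
have z' (g : edge X) o : 0 < depth e' o -> g <> e' -> depth g o = 0.
  move=> /tent_gt0[t [oe _]] ge; apply: tent_off_edge oe; exact/nesym.
rewrite (z e' p) in lip; [|lra|exact/nesym].
by rewrite (z' e q) in lip; [lra|lra|].
Qed.

(** Extend [depth e] outside the edge by minus the distance to the nearer end: the result is
    1-Lipschitz, at least [r] at [p] and at most [- r] at [q]. *)
Lemma depth_escape e r p q : 0 < r -> r <= depth e p -> depth e q = 0 ->
    r <= gdist q (Vertex (src e)) -> r <= gdist q (Vertex (tgt e)) ->
  2 * r <= gdist p q.
Proof.
move=> r0 hp hq hs ht.
pose m o := Num.min (gdist o (Vertex (src e))) (gdist o (Vertex (tgt e))).
pose f o := if 0 < depth e o then depth e o else - m o.
have m0 o : 0 <= m o by rewrite le_min !gdist_ge0.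
have mlip o o' : m o - m o' <= gdist o o'.
  have h1 := gdist_triangle o' o (Vertex (src e)).
  have h2 := gdist_triangle o' o (Vertex (tgt e)).
  by rewrite /m; minmax.
have fe t o : on_edge e t o -> f o = depth e o.
  move=> eo; rewrite /f; case: ltP => // d0.
  have : depth e o = 0 by apply/eqP; rewrite eq_le d0 tent_ge0.
  move=> ->; suff : m o = 0 by move=> ->; rewrite oppr0.
  case: o eo d0 => [v|e' t' te] /=; last first.
    move=> [ee _]; rewrite /depth /=; case: pselect => [{}ee|/(_ (esym ee))//] /=.
    subst e'; by have /andP[? ?] := te; minmax.
  case=> -[_ ->] _; apply/eqP; rewrite eq_le m0 andbT /m gdistxx ge_min lexx ?orbT //.
have fo e' t o : e' <> e -> on_edge e' t o -> f o = - m o.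
  by move=> ne /(tent_off_edge e e' 0 (edge_len e) t o ne); rewrite /f /depth => ->; rewrite ltxx.
have lip : f p - f q <= gdist p q.
  apply: gdist_lipschitz => e' s t p' q' ep eq.
  have [ee|ne] := pselect (e' = e).
    subst e'; rewrite (fe _ _ ep) (fe _ _ eq).
    by apply: le_trans (tent_lip _ _ _ _ _ _ _) (gdist_on_edge _ _ _ _ _ ep eq).
  rewrite (fo _ _ _ ne ep) (fo _ _ _ ne eq).
  have := mlip q' p'; have := gdist_on_edge _ _ _ _ _ ep eq.
  by rewrite (gdist_sym q'); lra.
move: lip; rewrite /f hq ltxx (lt_le_trans r0 hp) /m.
by minmax.
Qed.

Lemma gdist_vertex (a : R) v w : 0 < a -> (a%:E < a_graph X)%E -> v <> w ->
  a <= gdist (Vertex v) (Vertex w).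
Proof.
move=> a0 aX vw.
have le e : src e <> tgt e -> a <= edge_len e.
  move=> st; rewrite -lee_fin; apply: le_trans (ltW aX) _.
  by apply: ereal_inf_lbound; exists e.
(* A cone of height [a] with apex [v]: it reaches 0 by the far end of every non-loop edge at [v],
   and is constantly [a] on loops at [v]. *)
pose g e t : R := if pselect (src e = v) then
    (if pselect (tgt e = v) then a else Num.max 0 (a - t))
  else if pselect (tgt e = v) then Num.max 0 (a - (edge_len e - t)) else 0.
pose f o := match o with
  | Vertex u => if pselect (u = v) then a else 0
  | Inner e t _ => g e t end.
have fE e t o : on_edge e t o -> f o = g e t.
  case: o => [u|e' t' te'] /=; last by move=> [-> ->].
  have := le e; have := edge_len_gt0 e; rewrite /g => l0 al.
  case=> -[-> ->]; case: pselect => sv; case: pselect => tv //=;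
    first [by minmax | have : a <= edge_len e by (apply: al => st; congruence)];
    by minmax.
have : f (Vertex v) - f (Vertex w) <= gdist (Vertex v) (Vertex w).
  apply: (@gdist_lipschitz _ _ f) => e s t p' q' ep eq; rewrite (fE _ _ _ ep) (fE _ _ _ eq).
  have h1 : s - t <= `|s - t| := ler_norm _.
  have h2 : t - s <= `|s - t| by rewrite distrC ler_norm.
  by rewrite /g; case: (pselect (src e = v)) => sv; case: (pselect (tgt e = v)) => tv /=; minmax.
rewrite /=; case: pselect => //= _; case: pselect => [wv|_] /=; last by rewrite subr0.
by case: vw.
Qed.

Lemma vertex_lip v (p q : gpoint X) :
  gdist p (Vertex v) - gdist q (Vertex v) <= gdist p q.
Proof. by have := gdist_triangle q p (Vertex v); lra. Qed.

Lemma depth_lip (e : edge X) p q : depth e p - depth e q <= gdist p q.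
Proof. exact: tent_lip. Qed.

Lemma tent_le0 (e : edge X) lo hi t p : 0 <= lo -> hi <= edge_len e -> on_edge e t p ->
  t < hi -> ~ 0 < tent e lo hi p -> t <= lo.
Proof.
move=> lo0 hil ep thi /negP; rewrite -leNgt (tent_on_edge _ _ _ _ _ lo0 hil ep).
by minmax.
Qed.

Lemma le_tent (e : edge X) lo hi t p m : 0 <= lo -> hi <= edge_len e -> on_edge e t p ->
  m <= t - lo -> m <= hi - t -> m <= tent e lo hi p.
Proof.
move=> lo0 hil ep h1 h2.
by rewrite (tent_on_edge _ _ _ _ _ lo0 hil ep) le_max le_min h1 h2 orbT.
Qed.

End Graph.

(** * Grouping finitely many masses and bracketing a level *)

(** Drop terms from the end until the next drop would fall below [theta] or empty the list; the
    excess is then at most one term. The prefix stays nonempty even for [theta = 0], which occurs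
    when [kappa = 1]. *)
Lemma peel {R : realType} {I : Type} (b : I -> R) (theta beta : R) (s : seq I) :
    0 <= theta -> (forall i, b i <= beta) -> s <> [::] ->
    theta <= \sum_(i <- s) b i ->
  exists s1 s2, [/\ s = s1 ++ s2, s1 <> [::] &
    theta <= \sum_(i <- s1) b i <= theta + beta].
Proof.
move=> th0 hb; elim/last_ind: s => // s x IH _.
rewrite -cats1 big_cat big_seq1 /= => hs.
case: (ltP (\sum_(i <- s) b i) theta) => [lt|ge].
  exists (s ++ [:: x]), [::]; rewrite cats0 big_cat big_seq1 /=; split => //.
    by case: (s).
  by have := hb x; lra.
have [s0|/IH/(_ ge)[s1 [s2 [-> n1 h1]]]] := pselect (s = [::]).
  exists [:: x], [::]; rewrite s0 big_seq1; split => //.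
  by move: hs ge; rewrite s0 big_nil; have := hb x; lra.
by exists s1, (s2 ++ [:: x]); rewrite catA; split.
Qed.

(** [f] may jump, so the level [y] is only bracketed, just before and at the first multiple of [eps]
    (truncated at [l]) where [f] is at most [y]. *)
Lemma discrete_ivt {R : realType} (f : R -> R) (l y eps : R) :
    0 <= l -> 0 < eps -> y <= f 0 -> f l <= y ->
  exists t t', [/\ 0 <= t, t <= t', t' <= l, t' <= t + eps & f t' <= y <= f t].
Proof.
move=> l0 e0 f0 fl.
pose u (n : nat) := Num.min (n%:R * eps) l.
have exn : exists n, f (u n) <= y.
  exists (Num.bound (l / eps)).
  rewrite /u min_r // -ler_pdivrMr //.
  by apply: ltW; apply: archi_boundP; rewrite divr_ge0 // ltW.
case: (ex_minnP exn) => -[|n] hn hmin.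
  exists 0, 0; move: hn; rewrite /u mul0r min_l // => hn; split=> //; first lra.
  by rewrite hn.
exists (u n), (u n.+1); split=> //.
- by rewrite le_min l0 mulr_ge0 // ltW.
- rewrite /u -natr1 mulrDl mul1r; by minmax.
- by rewrite ge_min lexx orbT.
- rewrite /u -natr1 mulrDl mul1r; by minmax.
- rewrite hn /= leNgt; apply/negP => /ltW /hmin; by rewrite ltnn.
Qed.

(** * Measures on a metric graph *)

Section Spread.
Context {d} {T : measurableType d} {R : realType} (P : probability T R).
Context {X : metric_graph R} (f : T -> gpoint X).

Definition nu (A : set T) : R := fine (P A).

Lemma nuE A : measurable A -> P A = (nu A)%:E.
Proof. by move=> mA; rewrite /nu fineK // fin_num_measure. Qed.

Lemma nu_ge0 A : 0 <= nu A.
Proof. exact: fine_ge0. Qed.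

Lemma nuT : nu setT = 1.
Proof. by rewrite /nu probability_setT. Qed.

Lemma nuU A B : measurable A -> measurable B -> A `&` B = set0 ->
  nu (A `|` B) = nu A + nu B.
Proof.
move=> mA mB AB; have mAB : measurable (A `|` B) by exact: measurableU.
have : P (A `|` B) = (P A + P B)%E by rewrite measureU.
by rewrite !nuE // -EFinD => -[].
Qed.

Lemma nu_le A B : measurable A -> measurable B -> A `<=` B -> nu A <= nu B.
Proof.
move=> mA mB AB; rewrite -lee_fin -!nuE //.
by apply: le_measure => //; rewrite inE.
Qed.

Lemma nuC A : measurable A -> nu (~` A) = 1 - nu A.
Proof.
move=> mA; rewrite -nuT -(setUv A) nuU ?setICr //; first lra.
exact: measurableC.
Qed.

Lemma nuD A B : measurable A -> measurable B -> nu A - nu B <= nu (A `\` B).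
Proof.
move=> mA mB; have mAB := measurableD mA mB.
have mI := measurableI _ _ mA mB.
have -> : nu A = nu (A `\` B) + nu (A `&` B).
  rewrite -nuU //; first by rewrite setUC setUIDK.
  by apply/seteqP; split=> t // -[[_ nb] [_ /nb]].
have : nu (A `&` B) <= nu B by apply: nu_le => // t [].
lra.
Qed.

Lemma nu_gt0 A : 0 < nu A -> A !=set0.
Proof.
move=> A0; apply/set0P/eqP => AE; move: A0.
by rewrite AE /nu measure0 ltxx.
Qed.

Definition separated (sigma : R) (A B : set T) :=
  forall g h, A g -> B h -> sigma <= gdist (f g) (f h).

(** The form in which compactness of the group is used: it reduces separated families indexed by
    infinitely many vertices or edges to finite ones. *)
Definition totally_bounded_map := forall eps : R, 0 < eps ->
  exists s : seq T, forall g, exists2 h, h \in s & gdist (f g) (f h) < eps.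

Hypothesis tb : totally_bounded_map.

Definition pool {I : eqType} (S : I -> set T) (s : seq I) : set T :=
  [set g | exists2 i, i \in s & S i g].

Lemma pool_cons {I : eqType} (S : I -> set T) i s :
  pool S (i :: s) = S i `|` pool S s.
Proof.
apply/seteqP; split=> g.
  by move=> [j]; rewrite inE => /orP[/eqP ->|js] Sj; [left|right; exists j].
by move=> [Si|[j js Sj]]; [exists i|exists j] => //; rewrite inE ?eqxx // js orbT.
Qed.

Lemma measurable_pool {I : eqType} (S : I -> set T) s :
  (forall i, measurable (S i)) -> measurable (pool S s).
Proof.
move=> mS; elim: s => [|i s IH]; last by rewrite pool_cons; exact: measurableU.
rewrite (_ : pool S [::] = set0) //.
by apply/seteqP; split=> g // -[].
Qed.

Lemma nu_pool {I : eqType} (S : I -> set T) s : (forall i, measurable (S i)) ->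
    (forall i j g, S i g -> S j g -> i = j) -> uniq s ->
  nu (pool S s) = \sum_(i <- s) nu (S i).
Proof.
move=> mS inj; elim: s => [_|i s IH /= /andP[isN us]].
  rewrite big_nil (_ : pool S [::] = set0); first by rewrite /nu measure0.
  by apply/seteqP; split=> g // -[].
rewrite pool_cons big_cons -IH // nuU //; first exact: measurable_pool.
apply/seteqP; split=> g // -[Si [j js Sj]].
by move: isN; rewrite (inj _ _ _ Si Sj) js.
Qed.

Lemma separated_inj {I : Type} (S : I -> set T) (sigma : R) : 0 < sigma ->
    (forall i j, i <> j -> separated sigma (S i) (S j)) ->
  forall i j g, S i g -> S j g -> i = j.
Proof.
move=> s0 sep i j g Si Sj; apply: contrapT => /sep/(_ _ _ Si Sj).
by rewrite gdistxx leNgt s0.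
Qed.

(** A point is within [sigma / 2] of at most one cell, so the values of [pick] on a finite
    [sigma / 2]-net include every nonempty cell. *)
Lemma hit_cells {I : eqType} (S : I -> set T) (sigma : R) : 0 < sigma ->
    (forall i j, i <> j -> separated sigma (S i) (S j)) ->
  exists s, [/\ uniq s, (forall i, i \in s -> S i !=set0) &
                forall i g, S i g -> i \in s].
Proof.
move=> s0 sep; have s20 : 0 < sigma / 2 by lra.
have [s hs] := tb _ s20.
pose closeto h i := exists2 g, S i g & gdist (f g) (f h) < sigma / 2.
pose pick h := if pselect (exists i, closeto h i) is left p then Some (projT1 (cid p)) else None.
exists (undup [seq i <- pmap pick s | `[< S i !=set0 >]]); split.
- exact: undup_uniq.
- by move=> i; rewrite mem_undup mem_filter => /andP[/asboolP].
move=> i g Sig; rewrite mem_undup mem_filter; apply/andP; split.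
  by apply/asboolP; exists g.
have [h hin dgh] := hs g.
rewrite mem_pmap; apply/mapP; exists h => //; rewrite /pick.
case: pselect => [ex|]; last by case; exists i, g.
case: cid => j /= [g' Sj dg'h]; congr Some; apply: contrapT => /sep/(_ _ _ Sig Sj).
have := gdist_triangle (f h) (f g) (f g'); rewrite (gdist_sym (f h)).
lra.
Qed.

(** A prefix of the list of cells takes mass between [theta] and [theta + beta], leaving at least
    [theta] to the rest; the two groups inherit the separation of the cells. *)
Lemma split_cells {I : eqType} (S : I -> set T) (sigma theta beta : R) (M : set T) :
    0 < sigma -> 0 < theta -> 0 <= beta -> (forall i, measurable (S i)) -> measurable M ->
    (forall i j, i <> j -> separated sigma (S i) (S j)) ->
    (forall i, S i !=set0 -> nu (S i) <= beta) ->
    (forall g, M g -> exists i, S i g) -> 2 * theta + beta <= nu M ->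
  exists A B, [/\ measurable A, measurable B, theta <= nu A, theta <= nu B &
                  separated sigma A B].
Proof.
move=> s0 th0 b0 mS mM sep hb cov hM.
have inj := separated_inj S sigma s0 sep.
have [s [us hit all]] := hit_cells S sigma s0 sep.
have hs : nu M <= \sum_(i <- s) nu (S i).
  rewrite -nu_pool //; apply: nu_le => //; first exact: measurable_pool.
  by move=> g /cov[i Si]; exists i => //; exact: all Si.
have hb' i : nu (S i) <= beta.
  by have [->|/set0P/hb//] := eqVneq (S i) set0; rewrite /nu measure0.
have sn : s <> [::] by move=> s_nil; move: hs; rewrite s_nil big_nil; lra.
have [||s1 [s2 [sE _ /andP[h1 h2]]]] := peel (fun i => nu (S i)) theta beta s _ hb' sn; try lra.
move: us; rewrite sE cat_uniq => /and3P[us1 /hasPn dis us2].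
exists (pool S s1), (pool S s2); split; try exact: measurable_pool.
- by rewrite nu_pool.
- rewrite nu_pool //; move: hs; rewrite sE big_cat /=; lra.
- move=> g h [i is1 Si] [j js2 Sj]; apply: sep Si Sj => ij.
  by move: (dis _ js2); rewrite /= -ij is1.
Qed.

(** * Measurable pieces of the graph and the mass of an edge *)

Definition lipschitz_measurable := forall u : gpoint X -> R,
  (forall p q, u p - u q <= gdist p q) -> forall t, measurable [set g | t < u (f g)].

Hypothesis mf : lipschitz_measurable.
Definition in_edge (e : edge X) := [set g | 0 < depth e (f g)].
Definition deep (r : R) (e : edge X) := [set g | r <= depth e (f g)].
Definition cball (r : R) (v : vertex X) := [set g | gdist (f g) (Vertex v) <= r].
Definition oball (r : R) (v : vertex X) := [set g | gdist (f g) (Vertex v) < r].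

Lemma measurable_le u : (forall p q, u p - u q <= gdist p q) ->
  forall t, measurable [set g | u (f g) <= t].
Proof.
move=> lu t; rewrite (_ : [set g | _] = ~` [set g | t < u (f g)]).
  by apply: measurableC; exact: mf.
by apply/seteqP; split=> g /=; rewrite leNgt => /negP.
Qed.

Lemma measurable_lt u : (forall p q, u p - u q <= gdist p q) ->
  forall t, measurable [set g | u (f g) < t].
Proof.
move=> lu t; rewrite (_ : [set g | _] = [set g | - t < - u (f g)]).
  by apply: (mf (fun p => - u p)) => p q; have := lu q p; rewrite gdist_sym; lra.
by apply/seteqP; split=> g /=; rewrite ltrN2.
Qed.

Lemma measurable_in_edge e : measurable (in_edge e).
Proof. by apply: (mf (depth e)) => p q; exact: depth_lip. Qed.

Lemma measurable_deep r e : measurable (deep r e).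
Proof.
rewrite (_ : deep r e = ~` [set g | depth e (f g) < r]).
  by apply: measurableC; apply: (measurable_lt (depth e)) => p q; exact: depth_lip.
by apply/seteqP; split=> g /=; rewrite /deep /= leNgt => /negP.
Qed.

Lemma measurable_cball r v : measurable (cball r v).
Proof. by apply: (measurable_le (fun p => gdist p (Vertex v))) => p q; exact: vertex_lip. Qed.

Lemma measurable_oball r v : measurable (oball r v).
Proof. by apply: (measurable_lt (fun p => gdist p (Vertex v))) => p q; exact: vertex_lip. Qed.

Hint Resolve measurable_in_edge measurable_deep measurable_cball measurable_oball : core.

Lemma deep_sep (r : R) e e' : 0 < r -> e <> e' -> separated (2 * r) (deep r e) (deep r e').
Proof. by move=> r0 ee' g h hg hh; exact: (depth_sep _ _ _ _ _ ee' hg hh r0). Qed.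

Lemma edge_mass_lt (W D c : R) (e : edge X) :
    0 < c -> 4 * c <= 1 -> 0 <= W -> W < D ->
    (forall A B sigma, measurable A -> measurable B -> c <= nu A -> c <= nu B ->
       separated sigma A B -> sigma <= W) ->
    (forall S, measurable S -> (forall g h, S g -> S h -> gdist (f g) (f h) <= D) ->
       nu S < c) ->
  nu (in_edge e) < 3 * c.
Proof.
move=> c0 c1 W0 WD HW HD; rewrite ltNge; apply/negP => big.
have l0 := edge_len_gt0 e; set l := edge_len e in l0.
pose Z t := [set g | 0 < tent e t l (f g)].
have mZ t : 0 <= t -> measurable (Z t) by move=> t0; apply: (mf (tent e t l)) => p q; exact: tent_lip.
pose psi t := nu (Z t).
have psi0 : 3 * c <= psi 0 by exact: big.
have psil : psi l = 0.
  rewrite /psi (_ : Z l = set0) ?/nu ?measure0 //.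
  by apply/seteqP; split=> g // /tent_gt0[t [_ ht]]; lra.
have [eps e0 eD] : exists2 eps, 0 < eps & W + 2 * eps <= D.
  by exists ((D - W) / 2); lra.
(* The four arcs are cut out at the levels [y], [y - c] and [y - 2 c] of [psi];
   the first one contains the complement of the edge, and truncating [y] at
   [1 - c] leaves it mass at least [c]. *)
pose y := Num.min (psi 0) (1 - c).
have y3 : 3 * c <= y by rewrite /y; minmax.
have y1 : y <= 1 - c by rewrite /y; minmax.
have y0 : y <= psi 0 by rewrite /y; minmax.
have [||||t1 [t1' [? ? ? ? /andP[h1' h1]]]] := discrete_ivt psi l y eps; rewrite ?psil; try lra.
have [||||t2 [t2' [? ? ? ? /andP[h2' h2]]]] := discrete_ivt psi l (y - c) eps; rewrite ?psil; try lra.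
have [||||t3 [t3' [? ? ? ? /andP[h3' h3]]]] := discrete_ivt psi l (y - 2 * c) eps; rewrite ?psil; try lra.
have ? : 0 <= t1' by lra.
have ? : 0 <= t2' by lra.
have ? : 0 <= t3' by lra.
(* The first arc is off the edge or at parameters up to [t1'], the third at parameters between [t2]
   and [t3']: [tent e t1' l] is 0 on the first and at least this minimum on the third. *)
have hw : Num.min (t2 - t1') (l - t3') <= W.
  apply: (HW (~` Z t1') (Z t2 `\` Z t3')).
  - by apply: measurableC; exact: mZ.
  - by apply: measurableD; exact: mZ.
  - by rewrite nuC; [move: h1'; rewrite /psi; lra|exact: mZ].
  - apply: le_trans (nuD _ _ _ _); try exact: mZ.
    by move: h2 h3'; rewrite /psi; lra.
  - move=> h g /negP; rewrite -leNgt => hh [Zg nZg].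
    have [t [et /andP[t2t tl]]] := tent_gt0 _ _ _ _ Zg.
    have tt3 : t <= t3' by exact: tent_le0 et tl nZg.
    have lip : tent e t1' l (f g) - tent e t1' l (f h) <= gdist (f g) (f h) by exact: tent_lip.
    rewrite gdist_sym; apply: le_trans lip.
    suff : Num.min (t2 - t1') (l - t3') <= tent e t1' l (f g) by lra.
    apply: (le_tent _ _ _ t) => //; rewrite ge_min; apply/orP;
      [left|right]; lra.
(* The second, respectively fourth, arc lies in a segment of length at most [W + 2 * eps], hence at
   most [D]. *)
have [t21|lt3] : t2 - t1' <= W \/ l - t3' <= W.
- by move: hw; rewrite ge_min => /orP[]; [left|right].
- have : nu (Z t1 `\` Z t2') < c.
    apply: HD; first by apply: measurableD; exact: mZ.
    move=> g h [Zg nZg] [Zh nZh].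
    have [t [et /andP[? ?]]] := tent_gt0 _ _ _ _ Zg.
    have [t' [et' /andP[? ?]]] := tent_gt0 _ _ _ _ Zh.
    have tt2 : t <= t2' by apply: tent_le0 et _ nZg.
    have t't2 : t' <= t2' by apply: tent_le0 et' _ nZh.
    apply: le_trans (gdist_on_edge _ _ _ _ _ et et') _.
    by rewrite ler_norml; apply/andP; split; lra.
  have := nuD (Z t1) (Z t2') (mZ _ _) (mZ _ _).
  by move: h1 h2'; rewrite /psi => h1 h2' /(_ _ _) h; have := h ltac:(done) ltac:(done); lra.
- have : nu (Z t3) < c; last by move: h3; rewrite /psi; lra.
  apply: HD; first exact: mZ.
  move=> g h Zg Zh.
  have [t [et /andP[? ?]]] := tent_gt0 _ _ _ _ Zg.
  have [t' [et' /andP[? ?]]] := tent_gt0 _ _ _ _ Zh.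
  apply: le_trans (gdist_on_edge _ _ _ _ _ et et') _.
  rewrite ler_norml; apply/andP; split; lra.
Qed.

(** * Contradiction when all sets of small diameter are light *)

Context (a k k' c W : R).
Hypotheses (a0 : 0 < a) (aX : (a%:E < a_graph X)%E).
Hypotheses (k'0 : 0 < k') (k'k : k' < k) (k1 : k <= 1) (W0 : 0 <= W).
Hypothesis cE : c = (k - k') / 4.

Hypothesis sepW : forall A B sigma, measurable A -> measurable B ->
  c <= nu A -> c <= nu B -> separated sigma A B -> sigma <= W.
Hypothesis sepP : forall A B, measurable A -> measurable B ->
  k / 3 <= nu A -> k / 3 <= nu B -> ~ separated (a / 2) A B.
Hypothesis sepQ : forall A B, measurable A -> measurable B -> A !=set0 ->
  (1 - k) / 3 <= nu A -> k' <= nu B -> ~ separated (a / 4) A B.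
(** What failure of the theorem yields: both alternatives imply [D + W <= s], as
    [28 / 25 = 53 / 25 - 1] and [53 / 25 <= pi / Num.sqrt 2]. *)
Hypothesis small_mass : forall S D, measurable S ->
  (forall g h, S g -> S h -> gdist (f g) (f h) <= D) ->
  D + W <= a / 2 \/ D <= 28 / 25 * W -> nu S < c.

(* [lra] does not look at section hypotheses. *)
Ltac bounds := move: (a0) (k'0) (k'k) (k1) (W0) (cE) => ha hk'0 hk'k hk1 hW0 hcE.
Let vertexD (v w : vertex X) : v <> w -> a <= gdist (Vertex v) (Vertex w).
Proof. exact: gdist_vertex. Qed.

Let edge_lt e : nu (in_edge e) < 3 * c.
Proof.
bounds.
(* [edge_mass_lt] needs [W < D], and [28 / 25 * W] exceeds [W] only for positive [W]. *)
have [Wa|Wa] := ltP W (a / 8).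
  apply: (edge_mass_lt W (a / 4)) => //; try lra.
  by move=> S mS hS; apply: (small_mass S (a / 4)) => //; left; lra.
apply: (edge_mass_lt W (28 / 25 * W)) => //; try lra.
by move=> S mS hS; apply: (small_mass S (28 / 25 * W)) => //; right.
Qed.

(** By [edge_lt] the complement of the edge has mass at least [k'], and it is [a / 4] away from the
    deep part. For [k = 1] the strict bound fails on an empty set. *)
Let deep_lt e : deep (a / 4) e !=set0 -> nu (deep (a / 4) e) < (1 - k) / 3.
Proof.
bounds.
move=> ne; rewrite ltNge; apply/negP => h.
apply: (sepQ (deep (a / 4) e) (~` in_edge e)) => //; first exact: measurableC.
  by rewrite nuC //; have := edge_lt e; lra.
move=> g g' hg /negP; rewrite -leNgt => hg'.
by move: (depth_lip e (f g) (f g')) hg hg'; rewrite /deep /=; lra.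
Qed.

Let ball_sep v w : v <> w -> separated (a / 2) (cball (a / 4) v) (cball (a / 4) w).
Proof.
bounds.
move=> /vertexD vw g h; rewrite /cball /= => hg hh.
have := gdist_triangle (f g) (Vertex v) (Vertex w).
have := gdist_triangle (f h) (f g) (Vertex w).
by rewrite (gdist_sym (Vertex v) (f g)); lra.
Qed.

(** Each peeled family has mass at most [(1 - k) / 3 + c <= (1 - k') / 3], a third of what [sepQ]
    forces after doubling the radii; the incomplete last family accounts for [(1 - k) / 3]. *)
Let count_vertices (s : seq {classic vertex X}) :
    (forall v : {classic vertex X}, nu (cball (a / 4) v) <= c) ->
    uniq s -> (forall v : {classic vertex X}, v \in s -> cball (a / 4) v !=set0) ->
  \sum_(v <- s) nu (cball (a / 4) v) <=
    1 / 3 * \sum_(v <- s) nu (oball (a / 2) v) + (1 - k) / 3.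
Proof.
bounds.
move=> hc; have [n] := ubnP (size s).
elim: n s => // n IH s sn us hit.
have h0 (s' : seq {classic vertex X}) : 0 <= \sum_(v <- s') nu (oball (a / 2) v).
  by apply: sumr_ge0 => v _; exact: nu_ge0.
have [lt|ge] := ltP (\sum_(v <- s) nu (cball (a / 4) v)) ((1 - k) / 3).
  by have := h0 s; lra.
have [sE|sN] := pselect (s = [::]).
  by rewrite sE !big_nil; lra.
have [|s1 [s2 [sE s1N /andP[h1 h1']]]] :=
  peel (fun v : {classic vertex X} => nu (cball (a / 4) v)) ((1 - k) / 3) c s _ hc sN ge.
  by lra.
move: us; rewrite sE cat_uniq => /and3P[us1 _ us2].
have big1 : 1 - k' <= \sum_(v <- s1) nu (oball (a / 2) v).
  rewrite leNgt; apply/negP => lt.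
  have inj (v w : {classic vertex X}) g : oball (a / 2) v g -> oball (a / 2) w g -> v = w.
    rewrite /oball /= => hv hw; apply: contrapT => /vertexD.
    have := gdist_triangle (f g) (Vertex v) (Vertex w).
    by rewrite (gdist_sym (Vertex v) (f g)); lra.
  have injc (v w : {classic vertex X}) g : cball (a / 4) v g -> cball (a / 4) w g -> v = w.
    by rewrite /cball /= => hv hw; apply: (inj v w g); rewrite /oball /=; lra.
  apply: (sepQ (pool (fun v : {classic vertex X} => cball (a / 4) v) s1)
               (~` pool (fun v : {classic vertex X} => oball (a / 2) v) s1)).
  - by apply: measurable_pool => v; exact: measurable_cball.
  - by apply: measurableC; apply: measurable_pool => v; exact: measurable_oball.
  - case: (s1) s1N sE => // v s1' _ sE.
    have [|g hg] := hit v; first by rewrite sE inE eqxx.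
    by exists g, v; rewrite ?inE ?eqxx.
  - by rewrite nu_pool.
  - by rewrite nuC ?nu_pool //; [lra|exact: measurable_pool].
  move=> g h [v vs]; rewrite /cball /= => hv nh.
  have : a / 2 <= gdist (f h) (Vertex v).
    by rewrite leNgt; apply/negP => lth; apply: nh; exists v.
  have := gdist_triangle (f g) (f h) (Vertex v); rewrite ?(gdist_sym (f h) (f g)); lra.
have s2n : (size s2 < n)%N.
  move: sn; rewrite sE size_cat ltnS; apply: leq_trans.
  by case: (s1) s1N => // v s1' _; rewrite /= addSn ltnS leq_addl.
have hit2 (v : {classic vertex X}) : v \in s2 -> cball (a / 4) v !=set0.
  by move=> vs; apply: hit; rewrite sE mem_cat vs orbT.
by have := IH s2 s2n us2 hit2; rewrite !big_cat /=; lra.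
Qed.

Let heavy_vertex : exists v, c <= nu (cball (a / 4) v).
Proof.
bounds.
apply: contrapT => nex.
have hc (v : {classic vertex X}) : nu (cball (a / 4) v) <= c.
  by rewrite leNgt; apply/negP => lt; apply: nex; exists v; exact: ltW.
have a20 : 0 < a / 2 by lra.
have [s [us hit all]] := hit_cells
  (fun v : {classic vertex X} => cball (a / 4) v) (a / 2) a20 ball_sep.
have inj := separated_inj (fun v : {classic vertex X} => cball (a / 4) v) _ a20 ball_sep.
pose F := pool (fun v : {classic vertex X} => cball (a / 4) v) s.
have mF : measurable F by exact: measurable_pool.
have FE : nu F = \sum_(v <- s) nu (cball (a / 4) v) by exact: nu_pool.
(* [(1 + k) / 3 = 2 * (k / 3) + (1 - k) / 3] is the threshold of [split_cells]. It leaves the balls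
   more than [(2 - k) / 3], the most that [count_vertices] allows. *)
have M_lt : nu (~` F) < (1 + k) / 3.
  rewrite ltNge; apply/negP => big.
  have [|||||||||A [B [mA mB hA hB sAB]]] := split_cells
    (fun e : {classic edge X} => deep (a / 4) e) (2 * (a / 4)) (k / 3) ((1 - k) / 3) (~` F).
  all: try lra.
  - by [].
  - exact: measurableC.
  - by move=> e e'; apply: deep_sep; lra.
  - by move=> e /deep_lt/ltW.
  - move=> g nF; have [||e he] := depth_gtP (a / 4) (f g); first lra.
      move=> v; rewrite ltNge; apply/negP => hv; apply: nF; exists v => //.
      exact: (all v g hv).
    by exists e; exact: ltW.
  - apply: (sepP A B) => //.
    by move: sAB; rewrite (_ : 2 * (a / 4) = a / 2); last lra.
have := count_vertices s hc us hit; rewrite -FE.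
have : \sum_(v <- s) nu (oball (a / 2) v) <= 1.
  rewrite -nu_pool //; last first.
    move=> v w g; rewrite /oball /= => hv hw; apply: contrapT => /vertexD.
    have := gdist_triangle (f g) (Vertex v) (Vertex w).
    by rewrite (gdist_sym (Vertex v) (f g)); lra.
  by rewrite -nuT; apply: nu_le => //; exact: measurable_pool.
by move: M_lt; rewrite nuC //; lra.
Qed.

(** The other vertices are at least [a] from [v], so the larger ball minus [cball r v] lies at depth
    at least [r] in edges. Were every piece light, [split_cells] would give two sets of mass [c] at
    distance [2 * r > W]. *)
Let heavy_leg r rho v : 0 < r -> W < 2 * r -> rho <= a - r -> nu (cball r v) < c ->
  4 * c <= nu (oball rho v) -> exists e, c <= nu (deep r e `&` oball rho v).
Proof.
bounds.
move=> r0 Wr hrho hr big; apply: contrapT => nex.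
have h e : nu (deep r e `&` oball rho v) <= c.
  by rewrite leNgt; apply/negP => lt; apply: nex; exists e; exact: ltW.
have [|||||||||A [B [mA mB hA hB sAB]]] := split_cells
    (fun e : {classic edge X} => deep r e `&` oball rho v) (2 * r) c c (oball rho v `\` cball r v).
all: try lra.
- by move=> e; exact: measurableI.
- exact: measurableD.
- by move=> e e' ee' g g' [hg _] [hg' _]; apply: (deep_sep _ _ _ r0 ee').
- by move=> e _; exact: h.
- move=> g [hg /negP]; rewrite -ltNge => hg'.
  have [||e he] := depth_gtP r (f g); first exact: ltW.
    move=> w; have [<-//|vw] := pselect (v = w).
    have := vertexD _ _ vw; have := gdist_triangle (f g) (Vertex v) (Vertex w).
    by move: hg; rewrite /oball /= (gdist_sym (Vertex v) (f g)); lra.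
  by exists e; split => //; exact: ltW.
- by have := nuD (oball rho v) (cball r v) (measurable_oball _ _) (measurable_cball _ _); lra.
- by have := sepW _ _ _ mA mB hA hB sAB; lra.
Qed.

Lemma mass_not_spread : False.
Proof.
bounds.
have [v hv] := heavy_vertex.
have Wa : 28 / 25 * W < a / 2.
  rewrite ltNge; apply/negP => aW.
  have : nu (cball (a / 4) v) < c; last by lra.
  apply: (small_mass _ (a / 2)) => //; last by right.
  move=> g h; rewrite /cball /= => hg hh.
  by have := gdist_triangle (Vertex v) (f g) (f h); rewrite (gdist_sym (Vertex v) (f h)); lra.
(* The larger of [a / 8] and [14 / 25 * W]: balls of this radius fall under [small_mass], while
   [2 * r] still exceeds [W]. *)
have [r [r8 r4 Wr rW]] : exists r, [/\ a / 8 <= r, r <= a / 4, W < 2 * r &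
    2 * r + W <= a / 2 \/ 2 * r <= 28 / 25 * W].
  have [h|h] := ltP (14 / 25 * W) (a / 8).
    by exists (a / 8); split; try lra; left; lra.
  by exists (14 / 25 * W); split; try lra; right; lra.
have r0 : 0 < r by lra.
have ball_lt w : nu (cball r w) < c.
  apply: (small_mass _ (2 * r)) => // g h; rewrite /cball /= => hg hh.
  by have := gdist_triangle (Vertex w) (f g) (f h); rewrite (gdist_sym (Vertex w) (f h)); lra.
have oball_lt w : nu (oball r w) < c.
  apply: le_lt_trans (ball_lt w); apply: nu_le => // g; exact: ltW.
have far rho g g' : cball (a / 4) v g -> ~ oball (a / 4 + rho) v g' ->
    rho <= gdist (f g) (f g').
  rewrite /cball /oball /= => hg /negP; rewrite -leNgt => hg'.
  by have := gdist_triangle (f g) (f g') (Vertex v); rewrite ?(gdist_sym (f g') (f g)); lra.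
(* Removing an edge and the balls at its two ends leaves mass more than [1 - 5 * c], which is at
   least [c] exactly when [c <= 1 / 6]. *)
have [c6|c6] := leP c (1 / 6).
  have hB : nu (~` oball (a / 4 + 2 * r) v) < c.
    rewrite ltNge; apply/negP => hB.
    have : 2 * r <= W; last by lra.
    apply: sepW hv hB _ => //; first exact: measurableC.
    by move=> g h; exact: far.
  rewrite nuC // in hB.
  have [|||||e he] := heavy_leg r (a / 4 + 2 * r) v; try lra; try exact: ball_lt.
  have hde : c <= nu (deep r e).
    by apply: le_trans he _; apply: nu_le => [||g []//]; [exact: measurableI|exact: measurable_deep].
  pose B := ~` in_edge e `\` oball r (src e) `\` oball r (tgt e).
  have mB1 : measurable (~` in_edge e `\` oball r (src e)).
    by apply: measurableD => //; exact: measurableC.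
  have mB : measurable B by exact: measurableD.
  have : nu B < c.
    rewrite ltNge; apply/negP => hB'.
    have : 2 * r <= W; last by lra.
    apply: sepW hde hB' _ => // g h hg [[/negP ne /negP ns] /negP nt].
    rewrite -leNgt in ne; rewrite -leNgt in ns; rewrite -leNgt in nt.
    apply: (depth_escape e) => //.
    by apply/eqP; rewrite eq_le ne tent_ge0.
  have := nuD _ _ mB1 (measurable_oball r (tgt e)).
  have := nuD _ _ (measurableC (measurable_in_edge e)) (measurable_oball r (src e)).
  rewrite nuC // -/B.
  by have := oball_lt (src e); have := oball_lt (tgt e); have := edge_lt e; lra.
(* For large [c], [sepQ] replaces [sepW]: its first set needs only [(1 - k) / 3 <= c], its second
   only [k' <= 1 - 4 * c], so just the ball at [v] is removed along with the edge. *)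
have k3 : (1 - k) / 3 <= c by lra.
have hB : nu (~` oball (a / 4 + a / 4) v) < k'.
  rewrite ltNge; apply/negP => hB.
  apply: (sepQ (cball (a / 4) v) _ (measurable_cball _ _) (measurableC (measurable_oball _ _)) _ _ hB).
  - by apply: nu_gt0; lra.
  - by lra.
  - by move=> g h; exact: far.
rewrite nuC // in hB.
have [|||||e he] := heavy_leg r (a / 4 + a / 4) v; try lra; try exact: ball_lt.
have mS := measurableI _ _ (measurable_deep r e) (measurable_oball (a / 4 + a / 4) v).
apply: (sepQ _ (~` in_edge e `\` oball r v) mS).
- by apply: measurableD => //; exact: measurableC.
- by apply: nu_gt0; lra.
- by lra.
- have := nuD _ _ (measurableC (measurable_in_edge e)) (measurable_oball r v).
  by rewrite nuC //; have := oball_lt v; have := edge_lt e; lra.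
move=> g h [hg hgv] [/negP ne /negP nv].
rewrite -leNgt in ne; rewrite -leNgt in nv.
(* Near an end other than [v] no ball was removed, but such points are far from [g], which is within
   [a / 2] of [v]. *)
have near_end w : w <> v -> gdist (f h) (Vertex w) < r -> a / 4 <= gdist (f g) (f h).
  move=> wv hw; have := vertexD _ _ wv.
  have := gdist_triangle (f g) (Vertex w) (Vertex v).
  have := gdist_triangle (f h) (Vertex w) (f g).
  by move: hgv; rewrite /oball /= (gdist_sym (Vertex w) (f h)) (gdist_sym (f h) (f g)); lra.
have end_far w : r <= gdist (f h) (Vertex w) \/ a / 4 <= gdist (f g) (f h).
  have [->|wv] := pselect (w = v); first by left.
  by have [|/(near_end _ wv)] := leP r (gdist (f h) (Vertex w)); [left|right].
have [hs|//] := end_far (src e); have [ht|//] := end_far (tgt e).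
have d0 : depth e (f h) = 0 by apply/eqP; rewrite eq_le ne tent_ge0.
by have := depth_escape e r (f g) (f h) r0 hg d0 hs ht; lra.
Qed.
End Spread.

(** * A numerical bound on [pi / Num.sqrt 2] *)

Lemma sin_le {R : realType} (x : R) : 0 < x -> sin x <= x.
Proof.
move=> x0; have [|y _] := @MVT R sin cos 0 x x0 (fun y _ => is_derive_sin y).
  by apply: continuous_subspaceT => y; exact: continuous_sin.
by rewrite sin0 !subr0 => ->; rewrite ler_piMl ?cos_le1 // ltW.
Qed.

(** Two angle doublings from [sin (3 / 8) <= 3 / 8] make [cos (3 / 2)] positive, as
    [2 * (23 / 32) ^+ 2 > 1]. *)
Lemma pi_gt3 {R : realType} : 3 < pi :> R.
Proof.
rewrite ltNge; apply/negP => pi3.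
have pi2 := @pi_ge2 R.
have : cos (3 / 2 : R) <= 0.
  rewrite -(@cos_pihalf R) leNgt ltr_cos ?in_itv /=; first by rewrite -leNgt; lra.
  - by apply/andP; split; lra.
  - by apply/andP; split; lra.
have -> : 3 / 2 = (3 / 8) *+ 2 *+ 2 :> R by lra.
rewrite !cos_mulr2n.
have s1 : sin (3 / 8 : R) <= 3 / 8 by apply: sin_le; lra.
have s0 : 0 <= sin (3 / 8 : R) by apply: sin_ge0_pi; apply/andP; split; lra.
have := cos2sin2 (3 / 8 : R); set C := cos _ ^+ 2; set S := sin _ => CE.
have S2 : S ^+ 2 <= 9 / 64 by rewrite expr2; have := ler_pM s0 s0 s1 s1; rewrite -/S; lra.
have C1 : 23 / 32 <= C *+ 2 - 1 by lra.
have c0 : 0 <= 23 / 32 :> R by lra.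
by rewrite expr2; have := ler_pM c0 c0 C1 C1; lra.
Qed.

Lemma pi_div_sqrt2 {R : realType} : 53 / 25 <= pi / Num.sqrt 2 :> R.
Proof.
have s0 : 0 < Num.sqrt 2 :> R by rewrite sqrtr_gt0; lra.
rewrite ler_pdivlMr //.
(* [75 / 53] is [3 / (53 / 25)], and its square exceeds 2. *)
have : Num.sqrt 2 <= 75 / 53 :> R.
  rewrite -[leRHS]ger0_norm; last by lra.
  by rewrite -sqrtr_sqr ler_sqrt ?expr2; lra.
by have := @pi_gt3 R; lra.
Qed.

(** * Separation along an orbit *)

Section Action.
Context {R : realType} {G : metricGroupType R} (mu : probability (borel G) R).
Context {X : metric_graph R}.
Hypothesis compactG : compact [set: G].

Lemma continuous_lipschitz_measurable (f : G -> gpoint X) : continuous f ->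
  lipschitz_measurable (f : borel G -> gpoint X).
Proof.
move=> cf u lu t; apply: sub_sigma_algebra => /=.
rewrite openE => g /= tu; rewrite /interior.
have e0 : 0 < u (f g) - t by rewrite subr_gt0.
have near_g := metricType_numDomainType.cvgr_dist_lt (cf g) e0.
apply: (filterS _ (near_g _)) => h.
rewrite /mdist /= => dh.
by have := lu (f g) (f h); lra.
Qed.

Lemma continuous_totally_bounded (f : G -> gpoint X) : continuous f ->
  totally_bounded_map (f : borel G -> gpoint X).
Proof.
move=> cf eps e0.
have := compactG; rewrite compact_cover => /(_ G setT (fun h => [set g | gdist (f g) (f h) < eps])).
case.
- move=> h _; rewrite openE => g /= dg; rewrite /interior.
  have e0' : 0 < eps - gdist (f g) (f h) by rewrite subr_gt0.
  have near_g := metricType_numDomainType.cvgr_dist_lt (cf g) e0'.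
  apply: (filterS _ (near_g _)) => g'.
  rewrite /mdist /= => dg'.
  by have := gdist_triangle (f g) (f g') (f h); rewrite (gdist_sym (f g') (f g)); lra.
- by move=> g _; exists g => //=; rewrite gdistxx.
move=> D _ cD; exists (enum_fset D) => g.
by have [h hD /= dh] := cD g I; exists h.
Qed.

(** Ensures that the supremum in [Sep] is an upper bound of its set. *)
Lemma mdist_bounded : exists M, forall g h : G, mdist g h <= M.
Proof.
have := compactG; rewrite compact_cover => /(_ G setT (fun h => (ball h 1)°)).
case.
- by move=> h _; exact: open_interior.
- by move=> g _; exists g => //; exact: nbhsx_ballx.
move=> D _ cD.
exists (1 + \sum_(h <- enum_fset D) \sum_(h' <- enum_fset D) mdist h h' + 1) => g g'.
have [h hD /interior_subset] := cD g I; rewrite ballEmdist /= => dh.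
have [h' hD' /interior_subset] := cD g' I; rewrite ballEmdist /= => dh'.
have le_sum (F : G -> R) s h0 : (forall y, 0 <= F y) -> h0 \in s -> F h0 <= \sum_(y <- s) F y.
  move=> F0; elim: s => // y s IH; rewrite inE big_cons => /orP[/eqP ->|/IH].
    by rewrite lerDl sumr_ge0.
  by have := F0 y; lra.
have : mdist h h' <= \sum_(h <- enum_fset D) \sum_(h' <- enum_fset D) mdist h h'.
  apply: le_trans (le_sum (fun h => \sum_(h' <- enum_fset D) mdist h h') _ _ _ hD).
    by apply: le_sum => // y; exact: mdist_ge0.
  by move=> y; apply: sumr_ge0 => y' _; exact: mdist_ge0.
have := @metric_triangle _ _ g h g'; have := @metric_triangle _ _ h h' g'.
rewrite (@metric_sym _ _ g h); lra.
Qed.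

Context (act : G -> gpoint X -> gpoint X) (x : gpoint X).

(* The infimum in [set_dist] need not be attained, but [omega_plus] only sees
   the values of [omega] strictly to the right of [Sep]. *)
Lemma separation_omega_plus (A B : set (borel G)) (al be sigma : R) :
    measurable A -> measurable B -> A !=set0 -> B !=set0 ->
    (al%:E <= mu A)%E -> (be%:E <= mu B)%E ->
    (forall g h, A g -> B h -> sigma <= mdist (act g x) (act h x)) ->
  (sigma%:E <= omega_plus act x (Sep mu al be))%E.
Proof.
move=> mA mB A0 B0 hA hB sep; rewrite /omega_plus.
set eta := Sep mu al be.
have nd : {in `]eta, +oo[ &, nondecreasing_fun (omega act x)}.
  move=> e1 e2 _ _ e12; apply: le_ereal_sup => _ [g [g' [d ->]]].
  by exists g, g'; split=> //; exact: le_trans e12.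
(* By monotonicity the right limit is the infimum of [omega] over [e > eta]. *)
rewrite (cvg_lim _ (nondecreasing_at_right_cvge (+oo%O) _ nd)) //.
apply: le_ereal_inf_tmp => y [e]; rewrite /= in_itv /= andbT => he <- {y}.
have [M hM] := mdist_bounded.
have lb (A' B' : set G) : has_lbound [set mdist a b | a in A' & b in B'].
  by exists 0 => _ [g _ [h _ <-]]; exact: mdist_ge0.
have : set_dist A B <= eta.
  apply: ub_le_sup; last by exists A, B.
  exists M => _ [A' [B' [_ _ [[g Ag] [h Bh]] ->]]].
  by apply: le_trans (hM g h); apply: ge_inf => //; exists g => //; exists h.
move=> /le_lt_trans /(_ he).
have ne : [set mdist a b | a in (A : set G) & b in (B : set G)] !=set0.
  by have [g Ag] := A0; have [h Bh] := B0; exists (mdist g h), g => //; exists h.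
move=> /(inf_lt ne)[_ [g Ag [h Bh <-]]] dgh.
apply: (@le_trans _ _ (mdist (act g x) (act h x))%:E); first by rewrite lee_fin sep.
by apply: ereal_sup_ubound; exists g, h; split=> //; exact: ltW.
Qed.

Hypothesis cont_act : continuous_action act.

Lemma continuous_orbit_map (g0 : G) : continuous (fun g => act (g0 * g)%g x).
Proof.
have [_ _ ca] := cont_act => g.
have fg : Filter (nbhs g) by exact: nbhs_filter.
have fg0 : Filter (nbhs g0) by exact: nbhs_filter.
have fgg : Filter (nbhs (g0 * g)%g) by exact: nbhs_filter.
have fx : Filter (nbhs x) by exact: nbhs_filter.
have cp := @cvg_pair _ _ _ _ _ _ fg fg0 fg (fun=> g0) id (@cvg_cst _ _ _ _ fg) (@cvg_id _ _).
have cm := cvg_comp _ _ cp (@mulg_continuous R G (g0, g)).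
have cg := @cvg_pair _ _ _ _ _ _ fg fgg fx _ (fun=> x) cm (@cvg_cst _ _ _ _ fg).
exact: (cvg_comp _ _ cg (ca ((g0 * g)%g, x))).
Qed.

Lemma continuous_orbit : continuous (fun g => act g x).
Proof.
have := continuous_orbit_map 1%g.
by under eq_fun do rewrite mul1g.
Qed.

Hypothesis haar_mu : is_haar mu.

Lemma rho_ge0 eta : (0 <= eta -> 0 <= rho act eta)%E.
Proof.
move=> e0; apply: ereal_sup_ubound; exists 1%g, x, x; by rewrite !mdistxx.
Qed.

(* A ball of the orbit and its translate by [g] have the same mass, so they
   cannot be far apart, while [rho] bounds the size of the translate. *)
Lemma heavy_ball_displacement (c D W : R) (s : \bar R) (g0 : G) :
    0 <= D -> 0 <= W -> omega_plus act x (Sep mu c c) = W%:E ->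
    ((D + W)%:E <= s)%E ->
    (c%:E <= mu [set g : G | (mdist (act g0 x) (act g x) <= D)%R])%E ->
  forall g : G, ((mdist (act g0 x) (act g (act g0 x)))%:E <= s + rho act s)%E.
Proof.
move=> D0 W0 WE hs hc g; set z := act g0 x.
have [_ actM _] := cont_act.
have s0 : (0 <= s)%E by apply: le_trans hs; rewrite lee_fin addr_ge0.
have Ds : (D%:E <= s)%E by apply: le_trans hs; rewrite lee_fin lerDl.
have := rho_ge0 _ s0; case rE: (rho act s) => [r| |] // r0; last first.
  by rewrite addey ?leey // gt_eqF // (lt_le_trans _ s0) // ltNyr.
pose A := [set h : G | mdist z (act h x) <= D].
pose B := [set h : G | mdist z (act (g^-1 * h)%g x) <= D].
have zlip (p q : gpoint X) : gdist z p - gdist z q <= gdist p q.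
  by have := gdist_triangle q z p; rewrite (gdist_sym q p); lra.
have mA : measurable (A : set (borel G)).
  exact: (measurable_le _ (continuous_lipschitz_measurable _ continuous_orbit) _ zlip D).
have mB : measurable (B : set (borel G)).
  exact: (measurable_le _ (continuous_lipschitz_measurable _ (continuous_orbit_map g^-1%g)) _ zlip D).
have BE : B = [set (g * h)%g | h in A].
  apply/seteqP; split=> h /=; first by exists (g^-1 * h)%g => //; rewrite mulVKg.
  by move=> [h' Ah' <-]; rewrite /B /= mulKg.
have muB : mu B = mu A by rewrite BE haar_mu.
have Ag0 : A g0 by rewrite /A /= mdistxx.
have : ((mdist z (act g z) - D - r)%:E <= omega_plus act x (Sep mu c c))%E.
  apply: (separation_omega_plus A B) => //.
  - by exists g0.
  - by exists (g * g0)%g; rewrite BE; exists g0.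
  - by rewrite muB.
  move=> h h' Ah; rewrite BE => -[h'' Ah'' <-]; rewrite actM.
  have hr : mdist (act g z) (act g (act h'' x)) <= r.
    rewrite -lee_fin -rE; apply: ereal_sup_ubound; exists g, z, (act h'' x); split=> //.
    by apply: le_trans Ds; rewrite lee_fin.
  have h1 := @metric_triangle _ _ z (act h x) (act g z).
  have h2 := @metric_triangle _ _ (act h x) (act g (act h'' x)) (act g z).
  rewrite (@metric_sym _ _ (act g _) (act g z)) in h2.
  by rewrite /A /= in Ah; lra.
rewrite WE lee_fin => hW.
apply: (@le_trans _ _ ((D + W)%:E + r%:E)%E); first by rewrite -EFinD lee_fin; lra.
by rewrite leeD2r.
Qed.

Lemma omega_plus_ge0 (al be : R) : al <= 1 -> be <= 1 ->
  (0 <= omega_plus act x (Sep mu al be))%E.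
Proof.
move=> a1 b1; apply: (separation_omega_plus setT setT) => //.
- by exists 1%g.
- by exists 1%g.
- by rewrite probability_setT lee_fin.
- by rewrite probability_setT lee_fin.
- by move=> g h _ _; exact: mdist_ge0.
Qed.

End Action.

(** * From the action to the mass distribution on the graph *)

Theorem proposition3p27 (R : realType) (G : metricGroupType R)
  (compactG : compact [set: G])
  (mu : probability (borel G) R) (haar_mu : is_haar mu)
  (X : metric_graph R) (act : G -> gpoint X -> gpoint X)
  (cont_act : continuous_action act)
  (a kappa kappa' : R) (x : gpoint X)
  (a_gt0 : 0 < a) (kappa_gt0 : 0 < kappa) (kappa'_gt0 : 0 < kappa')
  (kappa_le1 : kappa <= 1)
  (lt_kappa : kappa' < kappa)
  (lt_a : (a%:E < a_graph X)%E)
  (small :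
    (maxe (2%:E * omega_plus act x (Sep mu (kappa / 3) (kappa / 3)))
          (4%:E * omega_plus act x (Sep mu ((1 - kappa) / 3) kappa'))
     < a%:E)%E) :
  let s : \bar R :=
    maxe ((a / 2)%:E + 2%:E * omega_plus act x (Sep mu (kappa / 3) kappa))%E
         ((pi / Num.sqrt 2)%:E *
           omega_plus act x
             (Sep mu ((kappa - kappa') / 4) ((kappa - kappa') / 4)))%E in
  exists2 z : gpoint X, act_orbit act x z &
    forall g : G, ((mdist z (act g z))%:E <= s + rho act s)%E.
Proof.
set c := (kappa - kappa') / 4; move=> s.
have K := separation_omega_plus mu compactG act x.
have nonneg := omega_plus_ge0 mu compactG act x.
have pi_s := @pi_div_sqrt2 R.
have s_a : ((a / 2)%:E <= s)%E.
  rewrite le_max leeDl ?mule_ge0 ?lee_fin //.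
  by apply: nonneg => //; lra.
have s_W : ((pi / Num.sqrt 2)%:E * omega_plus act x (Sep mu c c) <= s)%E.
  by rewrite le_max lexx orbT.
have W0 : (0 <= omega_plus act x (Sep mu c c))%E by apply: nonneg; rewrite /c; lra.
(* If this limit is infinite, so is [s], and any point of the orbit will do. *)
have [WE|Wfin] := eqVneq (omega_plus act x (Sep mu c c)) +oo%E.
  exists (act 1%g x); first by exists 1%g.
  move=> g; have sE : s = +oo%E.
    apply/eqP; rewrite eq_le leey /=; apply: le_trans s_W.
    by rewrite WE gt0_muley // lte_fin; lra.
  have := rho_ge0 act x s; rewrite sE => /(_ (leey _)).
  by case: (rho act +oo%E) => [r| |] // _; rewrite leey.
case WE : (omega_plus act x (Sep mu c c)) W0 Wfin => [W| |] // W0 _.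
rewrite lee_fin in W0; rewrite WE -EFinM in s_W.
have co := continuous_orbit act x cont_act.
have mf := continuous_lipschitz_measurable _ co.
have tb := continuous_totally_bounded compactG _ co.
apply: contrapT => nex.
have nuE' (A : set (borel G)) r : measurable A -> r <= nu mu A -> (r%:E <= mu A)%E.
  by move=> mA hr; rewrite nuE // lee_fin.
move: small; rewrite gt_max => /andP[small1 small2].
have cE : c = (kappa - kappa') / 4 by [].
have c0 : 0 < c by rewrite cE; lra.
apply: (@mass_not_spread _ _ _ mu X (fun g : borel G => act g x) tb mf a kappa kappa' c W) => //.
- move=> A B sigma mA mB hA hB sep; rewrite -lee_fin -WE.
  by apply: (K A B) => //; [apply: (nu_gt0 mu); lra|apply: (nu_gt0 mu); lra|exact: nuE'|exact: nuE'].
- move=> A B mA mB hA hB sep.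
  have : ((a / 2)%:E <= omega_plus act x (Sep mu (kappa / 3) (kappa / 3)))%E.
    by apply: (K A B) => //; [apply: (nu_gt0 mu); lra|apply: (nu_gt0 mu); lra|exact: nuE'|exact: nuE'].
  move: small1; case: (omega_plus _ _ _) => [w| |] //.
    by rewrite -EFinM lte_fin lee_fin; lra.
  by rewrite gt0_muley // lte_fin.
- move=> A B mA mB A0 hA hB sep.
  have : ((a / 4)%:E <= omega_plus act x (Sep mu ((1 - kappa) / 3) kappa'))%E.
    by apply: (K A B) => //; [apply: (nu_gt0 mu); lra|exact: nuE'|exact: nuE'].
  move: small2; case: (omega_plus _ _ _) => [w| |] //.
    by rewrite -EFinM lte_fin lee_fin; lra.
  by rewrite gt0_muley // lte_fin.
(* A heavy set of diameter at most [D] lies in the ball of radius [D] about any of its points, which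
   is then heavy too. *)
move=> S D mS hS hD; rewrite ltNge; apply/negP => big; apply: nex.
have [g0 Sg0] : S !=set0 by apply: (nu_gt0 mu); lra.
exists (act g0 x); first by exists g0.
have D0 : 0 <= D by apply: le_trans (hS _ _ Sg0 Sg0); rewrite gdist_ge0.
apply: (heavy_ball_displacement mu compactG act x cont_act haar_mu c D W) => //.
  case: hD => hD; first by apply: le_trans s_a; rewrite lee_fin.
  apply: le_trans s_W; rewrite lee_fin.
  have := ler_wpM2r W0 pi_s; lra.
have mball : measurable ([set g : G | mdist (act g0 x) (act g x) <= D] : set (borel G)).
  apply: (measurable_le _ mf (fun p => mdist (act g0 x) p)) => p q.
  by have := gdist_triangle q (act g0 x) p; rewrite (gdist_sym q p) /mdist /=; lra.
apply: nuE' => //; apply: le_trans big _; apply: nu_le => // g Sg.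
exact: hS.
Qed.
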